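(* Assume $\theta\ge1$. For all $0\le i\le I$ and $j\in\{1,2\}$ define $$U_{i,j}:=\sup\{Z_{i,j}:\ Z=(Z_1,Z_2)\text{ is a discrete subsolution of (D) that is nondecreasing with respect to } i\}.$$ Then $U=(U_1,U_2)$ is a solution of the discrete HJB system (D).
   Context: Parameters: $\gamma>1$, $0<\psi<1$, $\rho>r>0$, $y_2>y_1>0$, $\lambda_1,\lambda_2>0$, and $\underline x$ with $\rho\underline x+y_1>0$. Set $\theta=\frac{1-\psi^{-1}}{1-\gamma}>0$ and $\bar\jmath=3-j$ for $j\in\{1,2\}$. For $v<0$ and $rx+y>0$: $H(x,y,v,p)=(rx+y)p+\frac{\rho^\psi}{\psi-1}p^{1-\psi}((1-\gamma)v)^{\frac{1-\gamma\psi}{1-\gamma}}$ if $p\ge0$, and $H=+\infty$ if $p<0$. Grid: $\underline x\le 0<\bar x$, $I\ge 1$ an integer, $\Delta x=(\bar x-\underline x)/I$, $x_i=\underline x+i\Delta x$ for $0\le i\le I$. A grid function is $V=(V_{i,j})_{0\le i\le I,\,j\in\{1,2\}}$ with strictly negative values. $\Delta^+V_{i,j}=(V_{i+1,j}-V_{i,j})/\Delta x$ for $i<I$, $\Delta^-V_{i,j}=(V_{i,j}-V_{i-1,j})/\Delta x$ for $i>0$ (the values of $\Delta^+V_{I,j}$, $\Delta^-V_{0,j}$ are arbitrary and play no role). Discrete Hamiltonian: for $v<0$ let $p_{\min}(x,y,v)=\rho(rx+y)^{-1/\psi}((1-\gamma)v)^{1-\theta}$ be the minimizer of $H(x,y,v,\cdot)$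 and $H_{\min}(x,y,v)=\min_pH(x,y,v,p)$. $H^\uparrow(x,y,v,p)=H(x,y,v,p)$ if $p\ge p_{\min}(x,y,v)$ and $H_{\min}(x,y,v)$ if $p<p_{\min}(x,y,v)$. $H^\downarrow(x,y,v,p)=H(x,y,v,p)$ if $0\le p\le p_{\min}(x,y,v)$, $H_{\min}(x,y,v)$ if $p>p_{\min}(x,y,v)$, $+\infty$ if $p<0$. $\boldsymbol H(x_i,y_j,v,p^F,p^B)$ equals $H^\uparrow(x_i,y_j,v,p^F)$ if $i=0$; $H^\uparrow(x_i,y_j,v,p^F)+H^\downarrow(x_i,y_j,v,p^B)-H_{\min}(x_i,y_j,v)$ if $0<i<I$; $H^\downarrow(x_i,y_j,v,p^B)$ if $i=I$. System (D): for all $0\le i\le I$, $j\in\{1,2\}$, $\frac\rho\theta V_{i,j}=\boldsymbol H(x_i,y_j,V_{i,j},\Delta^+V_{i,j},\Delta^-V_{i,j})+\lambda_j(V_{i,\bar\jmath}-V_{i,j})$. A discrete subsolution (resp. supersolution) of (D) is a grid function satisfying this with $=$ replaced by $\le$ (resp. $\ge$) for all $0\le i\le I$, $j\in\{1,2\}$. *)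

(* Defs.v *)
From HB Require Import structures.
From mathcomp Require Import all_boot all_order all_algebra.
From mathcomp Require Import all_classical all_reals all_analysis.

Set Implicit Arguments.
Unset Strict Implicit.
Unset Printing Implicit Defensive.

Import Order.TTheory GRing.Theory Num.Theory.

Local Open Scope classical_set_scope.
Local Open Scope ring_scope.

(* The index j in {1, 2} is encoded by 'I_2: j = 1 is ord0, j = 2 is ord_max. *)
Record params (R : realType) := Params {
  gam : R;
  psi : R;
  rho : R;
  r : R;
  y : 'I_2 -> R;
  lam : 'I_2 -> R;
  xlo : R;
  xhi : R
}.

Section Model.
Context {R : realType} (P : params R).

Record standing : Prop := Standing {
  gam_gt1 : 1 < gam P;
  psi_gt0 : 0 < psi P;
  psi_lt1 : psi P < 1;
  r_gt0 : 0 < r P;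
  r_lt_rho : r P < rho P;
  y1_gt0 : 0 < y P ord0;
  y1_lt_y2 : y P ord0 < y P ord_max;
  lam_gt0 : forall j, 0 < lam P j;
  xlo_income : 0 < rho P * xlo P + y P ord0;
  xlo_le0 : xlo P <= 0;
  xhi_gt0 : 0 < xhi P
}.

Definition theta : R := (1 - (psi P)^-1) / (1 - gam P).

(* Only meaningful for v < 0 and 0 < r x + y. *)
Definition ham (x y v p : R) : \bar R :=
  if 0 <= p then
    ((r P * x + y) * p
     + rho P `^ psi P / (psi P - 1) * p `^ (1 - psi P)
       * ((1 - gam P) * v) `^ ((1 - gam P * psi P) / (1 - gam P)))%:E
  else +oo%E.

Definition p_min (x y v : R) : R :=
  rho P * (r P * x + y) `^ (- (psi P)^-1) * ((1 - gam P) * v) `^ (1 - theta).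

Definition ham_min (x y v : R) : \bar R := ereal_inf (range (ham x y v)).

Definition ham_up (x y v p : R) : \bar R :=
  if p_min x y v <= p then ham x y v p else ham_min x y v.

Definition ham_down (x y v p : R) : \bar R :=
  if p < 0 then +oo%E
  else if p <= p_min x y v then ham x y v p else ham_min x y v.

Section Grid.
(* The grid has n + 1 points, n being the number of cells. *)
Variable n : nat.

Notation grid_fun := ('I_n.+1 -> 'I_2 -> R).

Definition dx : R := (xhi P - xlo P) / n%:R.

Definition grid (i : 'I_n.+1) : R := xlo P + i%:R * dx.

(* For i = n (resp. i = 0) the forward (resp. backward) difference takes a junk
   value, which disc_ham ignores. *)
Definition dfwd (V : grid_fun) (i : 'I_n.+1) (j : 'I_2) : R :=
  (V (inord i.+1) j - V i j) / dx.

Definition dbwd (V : grid_fun) (i : 'I_n.+1) (j : 'I_2) : R :=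
  (V i j - V (inord i.-1) j) / dx.

Definition disc_ham (i : 'I_n.+1) (j : 'I_2) (v pF pB : R) : \bar R :=
  let x := grid i in
  if i == 0%N :> nat then ham_up x (y P j) v pF
  else if i == n :> nat then ham_down x (y P j) v pB
  else (ham_up x (y P j) v pF + ham_down x (y P j) v pB
        - ham_min x (y P j) v)%E.

Definition lhs (V : grid_fun) (i : 'I_n.+1) (j : 'I_2) : \bar R :=
  (rho P / theta * V i j)%:E.

(* rev_ord exchanges the two elements of 'I_2. *)
Definition rhs (V : grid_fun) (i : 'I_n.+1) (j : 'I_2) : \bar R :=
  (disc_ham i j (V i j) (dfwd V i j) (dbwd V i j)
   + (lam P j * (V i (rev_ord j) - V i j))%:E)%E.

Definition negative (V : grid_fun) : Prop := forall i j, V i j < 0.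

Definition solution (V : grid_fun) : Prop :=
  negative V /\ forall i j, lhs V i j = rhs V i j.

Definition subsolution (V : grid_fun) : Prop :=
  negative V /\ forall i j, (lhs V i j <= rhs V i j)%E.

Definition nondecreasing_grid (V : grid_fun) : Prop :=
  forall (i k : 'I_n.+1) j, (i <= k)%N -> V i j <= V k j.

(* The library's sup is 0 on sets that are empty or unbounded above, so
   negativity of perron entails that these suprema are genuine. *)
Definition perron : grid_fun := fun i j =>
  sup [set Z i j | Z in [set Z | subsolution Z /\ nondecreasing_grid Z]].

End Grid.
End Model.

(* Main.v *)
Require Import Defs.
From mathcomp Require Import all_boot all_order all_algebra.
From mathcomp Require Import all_classical all_reals all_analysis.
From mathcomp Require Import ring lra.
Import Order.TTheory GRing.Theory Num.Theory.
Import numFieldTopology.Exports.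
Local Open Scope ring_scope.

(* For nondecreasing grid functions the defect [rhs - lhs] of (D) at a point is a
   finite real number; it is continuous and, as [theta >= 1], nonincreasing in
   the value at that point, and it is nondecreasing in the neighbouring values.
   This yields a comparison principle, hence with an explicit affine
   supersolution the negativity of the Perron function [U], and continuity makes
   [U] a subsolution.  If the defect of [U] were positive at [i], then [U] could
   be raised at [i] unless [U i = U (i + 1)]; but in that case the defect is
   also positive at [i + 1], so moving to the right one reaches a point at which
   raising [U] is possible, a contradiction. *)

(** * The Hamiltonian on the real line *)

Section RealHamiltonian.
Context {R : realType}.
Implicit Types c K p s t psi : R.

(** Concavity: the tangent at [s] lies above the graph. Young's inequality with exponents
    [1 / (1 - psi)] and [1 / psi] is the case of base point 1; homogeneity gives the rest. *)
Lemma powR_tangent psi s t : 0 < psi < 1 -> 0 < s -> 0 <= t ->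
  t `^ (1 - psi) <= s `^ (1 - psi) + (1 - psi) * s `^ (- psi) * (t - s).
Proof.
move=> /andP[psi0 psi1] s0 t0.
have u0 : 0 <= t / s by rewrite divr_ge0// ltW.
have a0 : 0 < 1 - psi by lra.
have young : (t / s) `^ (1 - psi) <= (1 - psi) * (t / s) + psi.
  have := @conjugate_powR R ((t / s) `^ (1 - psi)) 1 (1 - psi)^-1 psi^-1
    (powR_ge0 _ _) ler01.
  rewrite !invr_gt0 !invrK a0 psi0 mulr1 powR1 mul1r -powRrM mulfV ?gt_eqF//.
  rewrite powRr1// [_ * (1 - psi)]mulrC; apply => //; lra.
have -> : t `^ (1 - psi) = s `^ (1 - psi) * (t / s) `^ (1 - psi).
  by rewrite -powRM ?(ltW s0)// [s * _]mulrC divfK// gt_eqF.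
have -> : s `^ (1 - psi) = s * s `^ (- psi).
  by rewrite powRD ?powRr1 ?ltW// (gt_eqF s0) implybT.
have : 0 <= s * s `^ (- psi) by rewrite mulr_ge0 ?powR_ge0 ?ltW.
move/ler_wpM2l => /(_ _ _ young) /le_trans; apply.
by rewrite le_eqVlt; apply/orP; left; apply/eqP; field; rewrite gt_eqF.
Qed.

Lemma powR_continuous_gt0 psi t : 0 < t ->
  {for t, continuous (fun t => t `^ psi)}.
Proof.
move=> t0; apply: differentiable_continuous; apply/derivable1_diffP.
by apply: derivable_powR; rewrite in_itv/= t0.
Qed.

(** Truncating at 0 gives continuity on the whole line, so that [hq] can be composed with slopes of
    any sign. *)
Lemma powR_pos_continuous psi : 0 < psi ->
  continuous (fun t => Num.max t 0 `^ psi : R).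
Proof.
move=> psi0 t.
have [t0|t0|->] := ltgtP t 0.
- have : \forall x \near t, 0 = Num.max x 0 `^ psi.
    near=> x; rewrite max_r ?powR0 ?gt_eqF//.
    by apply/ltW; near: x; exact: lt_nbhsl.
  move=> h; rewrite /continuous_at.
  apply: (cvg_trans (near_eq_cvg h)).
  by rewrite /= max_r ?ltW// powR0 ?gt_eqF//; exact: cvg_cst.
- have : \forall x \near t, x `^ psi = Num.max x 0 `^ psi.
    near=> x; rewrite max_l//.
    by apply/ltW; near: x; exact: lt_nbhsr.
  move=> h; rewrite /continuous_at.
  apply: (cvg_trans (near_eq_cvg h)).
  rewrite /= max_l ?ltW//.
  exact: powR_continuous_gt0.
- apply/cvgrPdist_lt => e e0.
  have /cvgrPdist_lt/(_ e e0) := powR_cvg0 psi0.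
  rewrite near_withinE maxxx powR0 ?gt_eqF// => h.
  near=> x; have [x0|x0] := ltP 0 x.
    by move: x0; near: x; exact: h.
  by rewrite powR0 ?gt_eqF// subrr normr0.
Unshelve. all: by end_near.
Qed.

(* With [K = rho * w ^ (1 - theta)], [w = (1 - gamma) * v] and [c = r * x + y],
   this is [H x y v p] on [0 <= p], and [pm] below is [p_min]. *)
Definition hq psi c K p := c * p - K `^ psi / (1 - psi) * Num.max p 0 `^ (1 - psi).

Definition pm psi c K := K * c `^ (- psi^-1).

(** * Minimizer, monotone branches and dependence on [K] of the convex Hamiltonian *)

Section Fixed.
Variables (psi c : R).
Hypotheses (psi01 : 0 < psi < 1) (c0 : 0 < c).
Let psi0 : 0 < psi. Proof. by case/andP: psi01. Qed.
Let a0 : 0 < 1 - psi. Proof. by case/andP: psi01 => _; rewrite subr_gt0. Qed.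

Lemma pm_gt0 K : 0 < K -> 0 < pm psi c K.
Proof. by move=> K0; rewrite mulr_gt0// powR_gt0. Qed.

Lemma ler_pm K L : K <= L -> pm psi c K <= pm psi c L.
Proof. by move=> KL; rewrite ler_wpM2r// powR_ge0. Qed.

(** First-order condition: the derivative [c - K ^ psi * p ^ (- psi)] of [hq] vanishes at [pm]. *)
Lemma pm_powR K : 0 < K -> c * pm psi c K `^ psi = K `^ psi.
Proof.
move=> K0; rewrite powRM ?powR_ge0 ?ltW// -powRrM mulNr mulVf ?gt_eqF//.
by rewrite powR_inv1 ?ltW// mulrCA mulfV ?mulr1 ?gt_eqF.
Qed.

Lemma hq0 K : hq psi c K 0 = 0.
Proof. by rewrite /hq maxxx powR0 ?gt_eqF// !mulr0 subr0. Qed.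

Lemma hq_incr K s t : 0 < K -> pm psi c K <= s -> s <= t ->
  hq psi c K s <= hq psi c K t.
Proof.
move=> K0 ps st; have p0 := pm_gt0 _ K0; have s0 := lt_le_trans p0 ps.
have t0 := lt_le_trans s0 st.
rewrite /hq !max_l ?(ltW s0) ?(ltW t0)//.
have tg := powR_tangent _ _ _ psi01 s0 (ltW t0).
(* The derivative of [hq] at [s] is nonnegative; with the tangent inequality at [s], convexity
   concludes. *)
have Ks : K `^ psi * s `^ (- psi) <= c.
  rewrite powRN ler_pdivrMr ?powR_gt0// -(pm_powR K K0) ler_pM2l//.
  by apply: ge0_ler_powR => //; rewrite ?nnegrE ltW.
have k0 : 0 <= K `^ psi / (1 - psi) by rewrite divr_ge0 ?powR_ge0 ?ltW.
have := ler_wpM2l k0 tg.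
have -> : K `^ psi / (1 - psi) * (s `^ (1 - psi) + (1 - psi) * s `^ (- psi) * (t - s))
  = K `^ psi / (1 - psi) * s `^ (1 - psi) + K `^ psi * s `^ (- psi) * (t - s).
  by field; rewrite gt_eqF.
have := ler_wpM2r (_ : 0 <= t - s) Ks; rewrite subr_ge0 => /(_ st).
set A := _ * s `^ (1 - psi); set B := _ * t `^ _; set D := K `^ psi * _ * (t - s).
lra.
Qed.

Lemma hq_decr K s t : 0 < K -> 0 <= s -> s <= t -> t <= pm psi c K ->
  hq psi c K t <= hq psi c K s.
Proof.
move=> K0 s0 st tp; have p0 := pm_gt0 _ K0; have t0 := le_trans s0 st.
(* The tangent is taken at the right endpoint [t], which must be positive; for [t = 0] the two
   points coincide. *)
move: t0; rewrite le_eqVlt => /predU1P[t0|t0].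
  by have -> : s = t by apply/le_anti; rewrite st -t0 s0.
rewrite /hq !max_l ?(ltW t0)//.
have tg := powR_tangent _ _ _ psi01 t0 s0.
have Ks : c <= K `^ psi * t `^ (- psi).
  rewrite powRN ler_pdivlMr ?powR_gt0// -(pm_powR K K0) ler_pM2l//.
  by apply: ge0_ler_powR; rewrite ?nnegrE// ltW.
have k0 : 0 <= K `^ psi / (1 - psi) by rewrite divr_ge0 ?powR_ge0 ?ltW.
have := ler_wpM2l k0 tg.
have -> : K `^ psi / (1 - psi) * (t `^ (1 - psi) + (1 - psi) * t `^ (- psi) * (s - t))
  = K `^ psi / (1 - psi) * t `^ (1 - psi) - K `^ psi * t `^ (- psi) * (t - s).
  by field; rewrite gt_eqF.
have := ler_wpM2r (_ : 0 <= t - s) Ks; rewrite subr_ge0 => /(_ st).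
set A := _ * s `^ (1 - psi); set B := _ * t `^ _; set D := K `^ psi * _ * (t - s).
lra.
Qed.

Lemma hq_min K p : 0 < K -> 0 <= p -> hq psi c K (pm psi c K) <= hq psi c K p.
Proof.
move=> K0 p0; have [pp|/ltW pp] := leP p (pm psi c K).
  exact: hq_decr.
exact: hq_incr.
Qed.

Lemma hq_anti K L p : 0 < K -> K <= L -> hq psi c L p <= hq psi c K p.
Proof.
move=> K0 KL; have L0 := lt_le_trans K0 KL.
rewrite /hq lerD2l lerN2 ler_wpM2r ?powR_ge0// ler_wpM2r ?invr_ge0 ?(ltW a0)//.
by apply: ge0_ler_powR; rewrite ?nnegrE// ltW.
Qed.

(* For [0 <= p], [eup K p] is [H^up - H_min] and [edown K p] is [H^down]: the
   discrete Hamiltonian is a sum of these, each separately monotone in [K]. *)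
Definition emin K := hq psi c K (pm psi c K).
Definition eup K p := hq psi c K (Num.max p (pm psi c K)) - emin K.
Definition edown K p := hq psi c K (Num.min (Num.max p 0) (pm psi c K)).

Lemma eup_ge0 K p : 0 < K -> 0 <= eup K p.
Proof. by move=> K0; rewrite subr_ge0 hq_incr// le_max lexx orbT. Qed.

Lemma eup_eq0 K p : p <= pm psi c K -> eup K p = 0.
Proof. by move=> pp; rewrite /eup max_r// subrr. Qed.

Lemma ler_eup K p q : 0 < K -> p <= q -> eup K p <= eup K q.
Proof.
move=> K0 pq; rewrite lerD2r; apply: hq_incr => //; first by rewrite le_max lexx orbT.
by rewrite ge_max !le_max pq lexx orbT.
Qed.

(** Past both minimizers, bounding [emin K] by the value of [hq] at [pm L] turns both sides into
    increments of [hq] from [pm L] to [p]. These decrease in [K] because [p ^ (1 - psi)] increases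
    in [p]. *)
Lemma eup_anti K L p : 0 < K -> K <= L -> eup L p <= eup K p.
Proof.
move=> K0 KL; have L0 := lt_le_trans K0 KL; have pKL := ler_pm _ _ KL.
have pK0 := pm_gt0 _ K0; have pL0 := pm_gt0 _ L0.
have [pp|/ltW pp] := leP p (pm psi c L); first by rewrite eup_eq0// eup_ge0.
rewrite /eup /emin !max_l//; last exact: le_trans pKL pp.
apply: (@le_trans _ _ (hq psi c K p - hq psi c K (pm psi c L))); last first.
  by rewrite lerD2l lerN2 hq_min// ltW.
have p0 := lt_le_trans pL0 pp.
rewrite /hq !max_l ?(ltW p0) ?(ltW pL0)//.
have : pm psi c L `^ (1 - psi) <= p `^ (1 - psi).
  by apply: ge0_ler_powR; rewrite ?nnegrE// ltW.
have : K `^ psi / (1 - psi) <= L `^ psi / (1 - psi).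
  rewrite ler_wpM2r ?invr_ge0 ?(ltW a0)//.
  by apply: ge0_ler_powR; rewrite ?nnegrE// ltW.
set A := _ / _; set B := _ / _; set C := _ `^ _; set D := _ `^ _; nra.
Qed.

Lemma edown0 K p : 0 < K -> p <= 0 -> edown K p = 0.
Proof.
by move=> K0 p0; rewrite /edown (max_r p0) min_l ?hq0// ltW// pm_gt0.
Qed.

Lemma emin_le_edown K p : 0 < K -> emin K <= edown K p.
Proof.
move=> K0; apply: hq_min => //.
by rewrite le_min le_max lexx orbT/= ltW// pm_gt0.
Qed.

Lemma edown_anti_slope K p q : 0 < K -> p <= q -> edown K q <= edown K p.
Proof.
move=> K0 pq; have pK0 := pm_gt0 _ K0.
have [pK|/ltW Kp] := leP (Num.max p 0) (pm psi c K); last first.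
  rewrite {2}/edown min_r// /edown min_r// (le_trans Kp)//.
  by rewrite ge_max !le_max pq lexx orbT.
rewrite {2}/edown (min_l pK); apply: hq_decr => //.
- by rewrite le_max lexx orbT.
- by rewrite le_min pK andbT ge_max !le_max pq lexx orbT.
- by rewrite ge_min lexx orbT.
Qed.

Lemma edown_le0 K p : 0 < K -> edown K p <= 0.
Proof.
move=> K0; have [p0|/ltW p0] := leP p 0; first by rewrite edown0.
by rewrite -(edown0 _ _ K0 (lexx 0)) edown_anti_slope.
Qed.

Lemma edownE K p : 0 <= p -> p <= pm psi c K -> edown K p = hq psi c K p.
Proof. by move=> p0 pK; rewrite /edown max_l// min_l. Qed.

(** [edown K p] is the minimum of [hq] over [[0, max p 0]], so it inherits monotonicity in [K] from
    [hq]. *)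
Lemma edown_le_hq K p q : 0 < K -> 0 <= q -> q <= Num.max p 0 ->
  edown K p <= hq psi c K q.
Proof.
move=> K0 q0 qp; have [qK|/ltW Kq] := leP q (pm psi c K).
  by apply: hq_decr; rewrite // ?le_min ?qp ?qK// ge_min lexx orbT.
by rewrite /edown min_r ?(le_trans Kq)// hq_min.
Qed.

Lemma edown_anti K L p : 0 < K -> K <= L -> edown L p <= edown K p.
Proof.
move=> K0 KL; have L0 := lt_le_trans K0 KL.
rewrite {2}/edown; set q := Num.min _ _.
apply: (le_trans _ (hq_anti _ _ q K0 KL)); apply: edown_le_hq => //.
  by rewrite le_min le_max lexx orbT/= ltW// pm_gt0.
by rewrite ge_min lexx.
Qed.

Lemma emin_anti K L : 0 < K -> K <= L -> emin L <= emin K.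
Proof.
move=> K0 KL; have L0 := lt_le_trans K0 KL; apply: (le_trans _ (hq_anti _ _ _ K0 KL)).
by rewrite hq_min// ltW// pm_gt0.
Qed.

(** [hq] is homogeneous of degree one in [(K, p)] jointly, and [pm] is linear in [K]. *)
Lemma emin_lin K : 0 < K -> emin K = K * emin 1.
Proof.
move=> K0; rewrite /emin /hq /pm mul1r powR1 !max_l ?mulr_ge0 ?powR_ge0 ?ltW//.
rewrite powRM ?powR_ge0 ?ltW// mulrBr mulrCA; congr (_ - _).
have -> : K `^ (1 - psi) = K / K `^ psi.
  by rewrite powRB ?powRr1 ?ltW// (gt_eqF K0) implybT.
by field; rewrite !gt_eqF// powR_gt0.
Qed.

Lemma hq_comp_continuous (K f : R -> R) (v : R) :
  0 < K v -> {for v, continuous K} -> {for v, continuous f} ->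
  {for v, continuous (fun v => hq psi c (K v) (f v))}.
Proof.
move=> K0 cK cf; apply: continuousB.
  by apply: continuousM => //; exact: cvg_cst.
apply: continuousM; last first.
  apply: (@continuous_comp _ _ _ f (fun t => Num.max t 0 `^ (1 - psi))) => //.
  exact: powR_pos_continuous.
apply: continuousM; last exact: cvg_cst.
apply: (@continuous_comp _ _ _ K (fun t => t `^ psi)) => //.
exact: powR_continuous_gt0.
Qed.

End Fixed.
End RealHamiltonian.

(** * The discrete system *)

Section GridProblem.
Context {R : realType} (P : params R) (n : nat).
Hypotheses (hP : standing P) (hn : (1 <= n)%N) (htheta : 1 <= theta P).
Implicit Types (i k : 'I_n.+1) (j : 'I_2) (v a b w : R) (V Z W : 'I_n.+1 -> 'I_2 -> R).

Local Notation psi := (psi P).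
Local Notation rho := (rho P).
Local Notation gam := (gam P).
Local Notation dx := (dx P n).
Local Notation grid := (@grid R P n).

Let psi01 : 0 < psi < 1. Proof. by rewrite (psi_gt0 hP) (psi_lt1 hP). Qed.
Let rho0 : 0 < rho. Proof. exact: lt_trans (r_gt0 hP) (r_lt_rho hP). Qed.
Let theta0 : 0 < theta P. Proof. exact: lt_le_trans htheta. Qed.
Let gam1 : 0 < gam - 1. Proof. by rewrite subr_gt0 (gam_gt1 hP). Qed.

Let n0 : 0 < n%:R :> R. Proof. by rewrite ltr0n. Qed.

Let dx0 : 0 < dx.
Proof.
by rewrite divr_gt0// subr_gt0 (le_lt_trans (xlo_le0 hP) (xhi_gt0 hP)).
Qed.

(** * Positivity of income, and the coefficient [K] as a function of the value *)

Definition inc i j : R := r P * grid i + y P j.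

Lemma ord2E j : j = ord0 \/ j = ord_max.
Proof. by case: j => [[|[|//]] h]; [left|right]; exact: val_inj. Qed.

Lemma y_bounds j : y P ord0 <= y P j <= y P ord_max.
Proof.
by case: (ord2E j) => ->; rewrite lexx ltW//= (y1_lt_y2 hP).
Qed.

Lemma grid_ge i : xlo P <= grid i.
Proof. by rewrite lerDl mulr_ge0// ltW. Qed.

Lemma grid_le i : grid i <= xhi P.
Proof.
have -> : xhi P = xlo P + n%:R * dx.
  by rewrite /dx mulrC divfK ?gt_eqF// addrC subrK.
by rewrite lerD2l ler_wpM2r ?ler_nat ?(ltW dx0)// -ltnS.
Qed.

Lemma inc_gt0 i j : 0 < inc i j.
Proof.
apply: (lt_le_trans (xlo_income hP)); apply: lerD; last by case/andP: (y_bounds j).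
apply: (@le_trans _ _ (r P * xlo P)).
  by rewrite ler_wnM2r ?(xlo_le0 hP)// ltW// (r_lt_rho hP).
by rewrite ler_wpM2l ?grid_ge// ltW// (r_gt0 hP).
Qed.

Definition kap v : R := rho * ((1 - gam) * v) `^ (1 - theta P).

Lemma wealth_gt0 v : v < 0 -> 0 < (1 - gam) * v.
Proof. by move=> v0; have := gam1; nra. Qed.

Lemma kap_gt0 v : v < 0 -> 0 < kap v.
Proof. by move=> v0; rewrite mulr_gt0// powR_gt0 ?wealth_gt0. Qed.

(** The base [(1 - gam) * v] decreases in [v], and the exponent [1 - theta] is nonpositive because
    [theta >= 1]. *)
Lemma ler_kap v w : v <= w -> w < 0 -> kap v <= kap w.
Proof.
move=> vw w0; have v0 := le_lt_trans vw w0.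
rewrite ler_wpM2l ?(ltW rho0)// -[1 - theta P]opprB !powRN.
rewrite lef_pV2 ?posrE ?powR_gt0 ?wealth_gt0//.
have h1 := wealth_gt0 v v0; have h2 := wealth_gt0 w w0.
apply: ge0_ler_powR; rewrite ?nnegrE ?subr_ge0 ?(ltW h1) ?(ltW h2)//.
by have := gam1; nra.
Qed.

Lemma kap_continuous v : v < 0 -> {for v, continuous kap}.
Proof.
move=> v0; apply: continuousM; first exact: cvg_cst.
apply: (@continuous_comp _ _ _ (fun v => (1 - gam) * v)
  (fun t => t `^ (1 - theta P))).
  by apply: continuousM; [exact: cvg_cst|exact: cvg_id].
by apply: powR_continuous_gt0; exact: wealth_gt0.
Qed.

(** * Reduction of the extended-real Hamiltonians to real functions *)

Lemma hamE x z v p : v < 0 -> 0 <= p ->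
  ham P x z v p = (hq psi (r P * x + z) (kap v) p)%:E.
Proof.
move=> v0 p0; have w0 := wealth_gt0 v v0.
rewrite /ham p0 /hq max_l//; congr (_%:E); congr (_ + _).
(* With this exponent, [rho ^ psi] and the power of the value merge into [kap v ^ psi]. *)
have -> : (1 - gam * psi) / (1 - gam) = (1 - theta P) * psi.
  rewrite /theta; field; have := gam1; have /andP[h _] := psi01.
  by move=> h1; rewrite (gt_eqF h) lt_eqF//; lra.
rewrite powRrM /kap [X in - (X / _ * _)]powRM ?powR_ge0 ?(ltW rho0)//.
have /andP[_ h] := psi01.
by field; rewrite !subr_eq0 (lt_eqF h) (gt_eqF h).
Qed.

Lemma p_minE x z v : p_min P x z v = pm psi (r P * x + z) (kap v).
Proof. by rewrite /p_min /pm /kap mulrAC. Qed.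

Section Point.
Variables (x z : R).
Hypothesis c0 : 0 < r P * x + z.
Local Notation c := (r P * x + z).

Lemma ham_minE v : v < 0 -> ham_min P x z v = (emin psi c (kap v))%:E.
Proof.
move=> v0; have K0 := kap_gt0 v v0; have p0 := pm_gt0 psi _ c0 _ K0.
apply/le_anti/andP; split.
  by apply: ereal_inf_lbound; exists (pm psi c (kap v)) => //; rewrite hamE// ltW.
apply: le_ereal_inf_tmp => _ [p _ <-].
have [p1|p1] := leP 0 p; last by rewrite /ham (leNgt 0 p) p1 /= leey.
by rewrite hamE// lee_fin hq_min.
Qed.

Lemma ham_upE v p : v < 0 ->
  ham_up P x z v p = (eup psi c (kap v) p + emin psi c (kap v))%:E.
Proof.
move=> v0; have K0 := kap_gt0 v v0; have p0 := pm_gt0 psi _ c0 _ K0.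
rewrite /ham_up p_minE ham_minE// /eup subrK.
have [pp|pp] := leP _ p.
  by rewrite hamE// (le_trans (ltW p0)).
by [].
Qed.

Lemma ham_downE v p : v < 0 -> 0 <= p ->
  ham_down P x z v p = (edown psi c (kap v) p)%:E.
Proof.
move=> v0 p0; rewrite /ham_down ltNge p0/= p_minE ham_minE// /edown (max_l p0).
by have [pp|pp] := leP p _; rewrite ?hamE.
Qed.

End Point.

(** The discrete Hamiltonian in terms of the right value [a] and the left value [b], regrouped as
    ([H^up - H_min]) + [H^down]. At [i = 0] the second summand becomes [H_min]; at [i = n] the first
    one disappears. *)
Definition flux i j v a b : R :=
  (if i == n :> nat then 0 else eup psi (inc i j) (kap v) ((a - v) / dx))
  + (if i == 0%N :> nat then emin psi (inc i j) (kap v)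
     else edown psi (inc i j) (kap v) ((v - b) / dx)).

Lemma disc_hamE i j v a b : v < 0 -> b <= v ->
  disc_ham P i j v ((a - v) / dx) ((v - b) / dx) = (flux i j v a b)%:E.
Proof.
move=> v0 bv; have c0 := inc_gt0 i j.
(* A nonnegative backward slope rules out the value [+oo] of [H^down]. *)
have s0 : 0 <= (v - b) / dx by rewrite divr_ge0 ?subr_ge0// ltW.
rewrite /disc_ham /flux -/grid; case: eqP => i0.
  have -> : (i == n :> nat) = false by rewrite i0 ltn_eqF.
  by rewrite ham_upE.
case: eqP => _; first by rewrite add0r ham_downE.
rewrite ham_upE// ham_downE// ham_minE//. by congr (_%:E); rewrite addrAC addrK.
Qed.

(** * Monotonicity and continuity of the scheme *)

Definition defect i j v a b w : R :=
  flux i j v a b + lam P j * (w - v) - rho / theta P * v.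

(** Raising [v] and lowering its neighbours decreases the forward slope, increases the backward
    slope and increases [kap]; each of these lowers the flux. *)
Lemma ler_defect i j v a b w v' a' b' w' :
  v <= v' -> v' < 0 -> a' <= a -> b' <= b -> w' <= w ->
  defect i j v' a' b' w' <= defect i j v a b w.
Proof.
move=> vv v0 aa bb ww; have v1 := le_lt_trans vv v0; have c0 := inc_gt0 i j.
have K0 := kap_gt0 v v1; have KK := ler_kap v v' vv v0.
have K1 := lt_le_trans K0 KK.
rewrite /defect /flux; apply: lerB; last first.
  by rewrite ler_wpM2l// divr_ge0// ltW.
apply: lerD; last by rewrite ler_wpM2l ?lerB// ltW// (lam_gt0 hP).
apply: lerD.
  case: eqP => _; first exact: lexx.
  apply: (le_trans (eup_anti _ _ psi01 c0 _ _ _ K0 KK)).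
  by apply: ler_eup => //; rewrite ler_wpM2r ?invr_ge0 ?(ltW dx0)// lerB.
case: eqP => _; first exact: emin_anti.
apply: (le_trans (edown_anti _ _ psi01 c0 _ _ _ K0 KK)).
by apply: edown_anti_slope => //; rewrite ler_wpM2r ?invr_ge0 ?(ltW dx0)// lerB.
Qed.

(** A common shift preserves the slopes and the coupling; [kap] grows, and the discount term makes
    the inequality strict. *)
Lemma ltr_defect_shift i j v a b w m : 0 < m -> v + m < 0 ->
  defect i j (v + m) (a + m) (b + m) (w + m) < defect i j v a b w.
Proof.
move=> m0 v0; have vv : v <= v + m by rewrite lerDl ltW.
have v1 := le_lt_trans vv v0; have c0 := inc_gt0 i j.
have K0 := kap_gt0 v v1; have KK := ler_kap v _ vv v0.
rewrite /defect /flux; apply: ler_ltB; last first.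
  by rewrite ltr_pM2l; [rewrite ltrDl|exact: divr_gt0].
have shift x y : (x + m) - (y + m) = x - y by ring.
rewrite !shift.
apply: lerD; last exact: lexx.
apply: lerD; case: eqP => _.
- exact: lexx.
- exact: eup_anti.
- exact: emin_anti.
- exact: edown_anti.
Qed.

Lemma defect_continuous i j v a b w : v < 0 ->
  {for v, continuous (fun v => defect i j v a b w)}.
Proof.
move=> v0; have c0 := inc_gt0 i j; have K0 := kap_gt0 v v0.
have cK := kap_continuous v v0.
have cid : {for v, continuous (fun v : R => v)} by exact: cvg_id.
have cc (t : R) : {for v, continuous (fun _ : R => t)} by exact: cvg_cst.
have cpm : {for v, continuous (fun v => pm psi (inc i j) (kap v))}.
  exact: continuousM.
have cmin : {for v, continuous (fun v => emin psi (inc i j) (kap v))}.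
  exact: hq_comp_continuous.
apply: continuousB; last exact: continuousM.
apply: continuousD; last by apply: continuousM => //; exact: continuousB.
apply: continuousD.
  case: eqP => // _; apply: continuousB => //.
  apply: hq_comp_continuous => //; apply: continuous_max => //.
  by apply: continuousM => //; exact: continuousB.
case: eqP => // _; apply: hq_comp_continuous => //.
apply: (@continuous_min _ _ (fun v => Num.max ((v - b) / dx) 0)) => //.
apply: continuous_max => //.
by apply: continuousM => //; exact: continuousB.
Qed.

Definition residual V i j : R :=
  defect i j (V i j) (V (inord i.+1) j) (V (inord i.-1) j) (V i (rev_ord j)).

Lemma rhsE V i j : negative V -> nondecreasing_grid V ->
  rhs P V i j = (residual V i j + rho / theta P * V i j)%:E.
Proof.
move=> V0 Vmono; rewrite /rhs disc_hamE//; last first.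
  by apply: Vmono; rewrite inordK ?leq_pred// (leq_ltn_trans (leq_pred _)).
by rewrite -EFinD /residual /defect subrK.
Qed.

Lemma subsolutionE V : negative V -> nondecreasing_grid V ->
  subsolution P V <-> forall i j, 0 <= residual V i j.
Proof.
move=> V0 Vmono; split=> [[_ h] i j|h].
  by have := h i j; rewrite rhsE// lee_fin lerDr.
by split=> // i j; rewrite rhsE// lee_fin lerDr.
Qed.

(** At a maximum point of [Z - W] with positive maximum [D], [Z] touches [W + D] from below.
    Monotonicity and the strict shift then make the residual of [Z] smaller than that of [W], hence
    negative. *)
Lemma comparison Z W : negative Z -> (forall i j, 0 <= residual Z i j) ->
  (forall i j, residual W i j <= 0) -> forall i j, Z i j <= W i j.
Proof.
move=> Z0 Zsub Wsup i0 j0.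
pose D (q : 'I_n.+1 * 'I_2) := Z q.1 q.2 - W q.1 q.2.
have [[i j] _ Dmax] := arg_maxP D (isT : xpredT (i0, j0)).
have {Dmax} le k l : Z k l <= W k l + D (i, j).
  by have := Dmax (k, l) isT; rewrite /D/=; lra.
have [D0|D0] := leP (D (i, j)) 0; first by have := le i0 j0; lra.
have E : W i j + D (i, j) = Z i j by rewrite /D/= addrC subrK.
have Zl : residual Z i j <= defect i j (W i j + D (i, j))
   (W (inord i.+1) j + D (i, j)) (W (inord i.-1) j + D (i, j))
   (W i (rev_ord j) + D (i, j)).
  by apply: ler_defect; rewrite ?E.
have := @ltr_defect_shift i j (W i j) (W (inord i.+1) j) (W (inord i.-1) j)
   (W i (rev_ord j)) _ D0; rewrite {1}E => /(_ (Z0 _ _)).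
have := Zsub i j; have := Wsup i j; rewrite /residual => h1 h2 h3.
by have := le_lt_trans Zl (lt_le_trans h3 h1); rewrite ltNge Zsub.
Qed.

(** * Barriers: a constant subsolution and an affine supersolution *)

Lemma constant_subsolution :
  exists2 v, v < 0 & forall i j, 0 <= residual (fun _ _ => v) i j.
Proof.
have [e eE] : {e : 'I_2 -> R | forall j, emin psi (inc ord0 j) 1 = e j}.
  by eexists.
have e_le0 j : e j <= 0.
  rewrite -eE.
  have h := @edown_le0 _ psi _ psi01 (inc_gt0 ord0 j) 1 0 ltr01.
  exact: (le_trans (emin_le_edown _ _ psi01 (inc_gt0 _ _) _ 0 ltr01) h).
have sum_le0 : theta P * (e ord0 + e ord_max) <= 0.
  by rewrite pmulr_rle0// -[leRHS]addr0 lerD.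
(* The first summand forces [(1 - gam) * v >= 1], hence [kap v <= rho]; the second gives
   [v <= theta * e j]. Together they settle [i = 0], where the flux is [kap v * e j]; at the other
   points it is 0. *)
have [v vE] : {v : R | v = - (gam - 1)^-1 + theta P * (e ord0 + e ord_max)}.
  by eexists.
have v0 : v < 0.
  by rewrite vE -[ltRHS]addr0 ltr_leD// oppr_lt0 invr_gt0.
have w1 : 1 <= (1 - gam) * v.
  have -> : (1 - gam) * v = 1 - (gam - 1) * (theta P * (e ord0 + e ord_max)).
    by rewrite vE; field; rewrite gt_eqF.
  by rewrite lerBrDr gerDl pmulr_rle0.
have K_le : kap v <= rho.
  rewrite /kap ger_pMr// -[leRHS](powRr0 ((1 - gam) * v)).
  by rewrite ler_powR// subr_le0.
exists v => // i j; have K0 := kap_gt0 v v0; have c0 := inc_gt0 i j.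
rewrite /residual /defect subrr mulr0 addr0 subr_ge0 /flux subrr mul0r.
rewrite eup_eq0 ?(ltW (pm_gt0 _ _ c0 _ K0))// if_same add0r.
have rt0 : 0 < rho / theta P by rewrite divr_gt0.
case: eqP => i0; last by rewrite edown0// pmulr_rle0// ltW.
have {i0} -> : i = ord0 by apply: val_inj.
rewrite emin_lin ?inc_gt0// eE.
apply: (@le_trans _ _ (rho * e j)); last by rewrite ler_wnM2r.
rewrite mulrAC ler_pdivrMr// -mulrA ler_pM2l//.
have ej : e ord0 + e ord_max <= e j.
  by case: (ord2E j) => ->; rewrite ?gerDl ?gerDr.
rewrite [leRHS]mulrC; apply: (le_trans _ (ler_wpM2l (ltW theta0) ej)).
by rewrite vE gerDr oppr_le0 invr_ge0 ltW.
Qed.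

(* For small slopes [s] the term in [s ^ (1 - psi)] of [H] dominates, so an affine
   [W] of slope [s] with values in [[- s * (1 + xhi - xlo), - s]] works. *)
Lemma affine_supersolution :
  exists2 W, negative W & forall i j, residual W i j <= 0.
Proof.
have [L LE] : {L : R | L = xhi P - xlo P} by eexists.
have [C CE] : {C : R | C = r P * xhi P + y P ord_max} by eexists.
have L0 : 0 < L by rewrite LE subr_gt0 (le_lt_trans (xlo_le0 hP) (xhi_gt0 hP)).
have incC i j : inc i j <= C.
  rewrite CE; apply: lerD; last by case/andP: (y_bounds j).
  by rewrite ler_wpM2l ?grid_le// ltW// (r_gt0 hP).
have C0 : 0 < C by exact: lt_le_trans (inc_gt0 ord0 ord0) (incC _ _).
have rt0 : 0 < rho / theta P by rewrite divr_gt0.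
have /andP[_ psi_lt1] := psi01.
have psi_pos : 0 < psi by case/andP: psi01.
have a0 : 0 < 1 - psi by rewrite subr_gt0.
have [D DE] : {D : R | D = (1 - psi) * (C + rho / theta P * (1 + L))} by eexists.
have D0 : 0 < D.
  by rewrite DE mulr_gt0// addr_gt0// mulr_gt0// addr_gt0.
(* The three bounds yield in turn: dominance of the power term ([key]), a slope left of every
   minimizer ([spm]), and values so close to 0 that [kap >= rho] ([Krho]). *)
have [s [s0 sD sC sg]] : exists s : R, [/\ 0 < s, s <= pm psi D rho,
    s <= pm psi C rho & s <= ((gam - 1) * (1 + L))^-1].
  exists (Num.min (pm psi D rho) (Num.min (pm psi C rho) ((gam - 1) * (1 + L))^-1)).
  split; rewrite ?ge_min ?lexx ?orbT//.
  by rewrite !lt_min !pm_gt0//= invr_gt0 mulr_gt0// addr_gt0.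
have level_pos i : 0 < 1 + (xhi P - grid i).
  by rewrite ltr_wpDr// subr_ge0 grid_le.
have level_le i : 1 + (xhi P - grid i) <= 1 + L.
  by rewrite lerD2l LE lerB// grid_ge.
pose W i j : R := - (s * (1 + (xhi P - grid i))).
have W0 : negative W by move=> i j; rewrite oppr_lt0 mulr_gt0.
have slope i k j : k = i.+1 :> nat -> (W k j - W i j) / dx = s.
  move=> ki; have -> : W k j - W i j = s * dx.
    by rewrite /W /grid ki -natr1; ring.
  by rewrite mulfK ?gt_eqF.
have Krho i j : rho <= kap (W i j).
  rewrite /kap ler_peMr ?(ltW rho0)//.
  have w0 := wealth_gt0 _ (W0 i j).
  rewrite -[leLHS](powRr0 ((1 - gam) * W i j)); apply: ger_powR; last first.
    by rewrite subr_le0.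
  rewrite w0/=; have -> : (1 - gam) * W i j = s * ((gam - 1) * (1 + (xhi P - grid i))).
    by rewrite /W; ring.
  apply: (@le_trans _ _ (s * ((gam - 1) * (1 + L)))).
    by rewrite ler_pM2l// ler_pM2l.
  by rewrite -ler_pdivlMr ?div1r// mulr_gt0// addr_gt0.
have hqW i j : hq psi (inc i j) (kap (W i j)) s <= rho / theta P * W i j.
  apply: (le_trans (hq_anti _ _ psi01 _ _ _ rho0 (Krho i j))).
  apply: (@le_trans _ _ (- (rho / theta P * (1 + L) * s))); last first.
    by rewrite /W mulrN lerN2 -mulrA ler_pM2l// [leRHS]mulrC ler_pM2l.
  rewrite /hq max_l ?(ltW s0)//.
  have -> : s `^ (1 - psi) = s * s `^ (- psi).
    by rewrite powRD ?powRr1 ?ltW// (gt_eqF s0) implybT.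
  (* By the first-order condition at income [D], this amounts to [s <= pm psi D rho]. *)
  have key : C + rho / theta P * (1 + L) <= rho `^ psi / (1 - psi) * s `^ (- psi).
    rewrite powRN ler_pdivlMr ?powR_gt0// ler_pdivlMr//.
    rewrite -(pm_powR psi D psi01 D0 _ rho0) {1}DE mulrAC [_ * (1 - psi)]mulrC.
    rewrite -DE ler_pM2l//; apply: ge0_ler_powR; rewrite ?nnegrE ?(ltW s0)//.
      exact: ltW.
    exact/ltW/pm_gt0.
  have := ler_wpM2r (ltW s0) key.
  have := ler_wpM2r (ltW s0) (incC i j).
  by move=> h1 h2; move: h1 h2; rewrite mulrDl; lra.
exists W => // i j; have K0 := kap_gt0 _ (W0 i j); have c0 := inc_gt0 i j.
have spm : s <= pm psi (inc i j) (kap (W i j)).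
  apply: (le_trans sC); apply: (le_trans (ler_pm _ C _ _ (Krho i j))).
  rewrite /pm ler_pM2l// !powRN lef_pV2 ?posrE ?powR_gt0//.
  by apply: ge0_ler_powR; rewrite ?nnegrE ?invr_ge0// ?ltW.
rewrite /residual /defect subrr mulr0 addr0 subr_le0.
(* The forward term vanishes, and the other one is [hq] at [s], or its minimum when [i = 0]. *)
apply: (le_trans _ (hqW i j)); rewrite /flux -[leRHS]add0r; apply: lerD.
  case: eqP => // /eqP i_n.
  rewrite slope ?eup_eq0// inordK// ltnS ltn_neqAle i_n -ltnS/=.
  exact: ltn_ord.
case: eqP => [_|/eqP i0]; first by rewrite hq_min// ltW.
rewrite slope; first by rewrite edownE// ltW.
by rewrite inordK ?prednK ?lt0n// ltnW.
Qed.

(** * The Perron function *)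

Local Notation U := (perron P (n := n)).

Definition perron_class Z := [/\ negative Z, nondecreasing_grid Z
  & forall i j, 0 <= residual Z i j].

Lemma perron_classE Z :
  (subsolution P Z /\ nondecreasing_grid Z) <-> perron_class Z.
Proof.
split=> [[Zsub Zmono]|[Z0 Zmono Zsub]].
  by split=> //; [case: Zsub|apply/subsolutionE => //; case: Zsub].
by split=> //; apply/subsolutionE.
Qed.

(** The barriers make the class nonempty and bounded above, so [sup] is a genuine supremum. *)
Let has_sup_perron i j :
  has_sup [set Z i j | Z in [set Z | subsolution P Z /\ nondecreasing_grid Z]]%classic.
Proof.
split.
  have [v v0 vsub] := constant_subsolution; exists v, (fun _ _ => v) => //.
  by apply/perron_classE; split.
have [W W0 Wsup] := affine_supersolution.
exists (W i j) => _ [Z /perron_classE[Z0 _ Zsub] <-].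
exact: comparison.
Qed.

Lemma perron_ub Z i j : perron_class Z -> Z i j <= U i j.
Proof.
by move=> /perron_classE ZP; apply: sup_upper_bound => //; exists Z.
Qed.

Lemma perron_le i j t : (forall Z, perron_class Z -> Z i j <= t) -> U i j <= t.
Proof.
move=> h; apply: ge_sup; first by case: (has_sup_perron i j).
by move=> _ [Z /perron_classE ZP <-]; exact: h.
Qed.

Lemma perron_adherent i j e : 0 < e ->
  exists2 Z, perron_class Z & U i j - e < Z i j.
Proof.
move=> e0; have [_ [Z /perron_classE ZP <-] h] := sup_adherent e0 (has_sup_perron i j).
by exists Z.
Qed.

Lemma perron_negative : negative U.
Proof.
move=> i j; have [W W0 Wsup] := affine_supersolution.
apply: le_lt_trans (W0 i j); apply: perron_le => Z [Z0 _ Zsub].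
exact: comparison.
Qed.

Lemma perron_nondecreasing : nondecreasing_grid U.
Proof.
move=> i k j ik; apply: perron_le => Z ZP.
by apply: le_trans (perron_ub _ k j ZP); case: ZP => _ + _; apply.
Qed.

(** A negative residual would stay negative with [U i j] replaced by a nearby [Z i j] from the
    class. Since [Z <= U] at the neighbours, the residual of [Z] would be negative too. Continuity
    in the central value alone suffices. *)
Lemma perron_residual_ge0 i j : 0 <= residual U i j.
Proof.
pose phi v := defect i j v (U (inord i.+1) j) (U (inord i.-1) j) (U i (rev_ord j)).
rewrite leNgt; apply/negP => res0.
have := defect_continuous i j _ (U (inord i.+1) j) (U (inord i.-1) j)
  (U i (rev_ord j)) (perron_negative i j).
move=> /cvgr_lt/(_ 0 res0) /nbhs_ballP[e /= e0 near_neg].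
have [Z ZP Ze] := perron_adherent i j _ e0.
have ZU := perron_ub _ i j ZP; have [Z0 _ Zsub] := ZP.
have : phi (Z i j) < 0 by apply: near_neg; rewrite /ball/= ger0_norm; lra.
rewrite ltNge => /negP; apply; apply: (le_trans (Zsub i j)).
by apply: ler_defect => //; exact: perron_ub.
Qed.

(** A zero forward slope lies left of the minimizer, so [eup] vanishes; what remains is at most [hq]
    at 0, which is 0. *)
Lemma flux_plateau_left i j v b : v < 0 -> (i < n)%N -> flux i j v v b <= 0.
Proof.
move=> v0 i_n; have c0 := inc_gt0 i j; have K0 := kap_gt0 v v0.
rewrite /flux (ltn_eqF i_n) subrr mul0r eup_eq0 ?(ltW (pm_gt0 _ _ c0 _ K0))//.
rewrite add0r; case: eqP => _; last exact: edown_le0.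
exact: (le_trans (emin_le_edown _ _ psi01 c0 _ 0 K0) (edown_le0 _ _ psi01 c0 _ _ K0)).
Qed.

Lemma flux_plateau_right i j v a : v < 0 -> (0 < i)%N -> 0 <= flux i j v a v.
Proof.
move=> v0 i_gt0; have c0 := inc_gt0 i j; have K0 := kap_gt0 v v0.
rewrite /flux (gtn_eqF i_gt0) subrr mul0r edown0// addr0.
by case: eqP => // _; exact: eup_ge0.
Qed.

(* Raising [U] at [(i, j)] alone keeps it in the Perron class. *)
Lemma perron_no_room i j :
  (forall k, (i < k)%N -> U i j < U k j) -> residual U i j <= 0.
Proof.
move=> room; rewrite leNgt; apply/negP => res0.
have := defect_continuous i j _ (U (inord i.+1) j) (U (inord i.-1) j)
  (U i (rev_ord j)) (perron_negative i j).
move=> /cvgr_gt/(_ 0 res0) near_pos.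
have [t [Ut t0 tpos troom]] : exists t, [/\ U i j < t, t < 0,
    0 < defect i j t (U (inord i.+1) j) (U (inord i.-1) j) (U i (rev_ord j)) &
    forall k, (i < k)%N -> t <= U k j].
  (* Starting the minimum from 0 keeps [t] negative, also when no index lies to the right of [i]. *)
  pose t0 := \big[Num.min/0]_(k : 'I_n.+1 | (i < k)%N) U k j.
  have Ut0 : U i j < t0.
    by apply: lt_bigmin; [exact: perron_negative|move=> k; exact: room].
  have /nbhs_ballP[e /= e0 ball_pos] := near_pos.
  pose d := Num.min (e / 2) ((t0 - U i j) / 2).
  have d0 : 0 < d by rewrite lt_min !divr_gt0// subr_gt0.
  have de : d <= e / 2 by rewrite ge_min lexx.
  have dt : d <= (t0 - U i j) / 2 by rewrite ge_min lexx orbT.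
  exists (U i j + d); split.
  - by rewrite ltrDl.
  - have : t0 <= 0 by apply: bigmin_le_id.
    by lra.
  - by apply: ball_pos; rewrite /ball/= opprD addNKr normrN gtr0_norm; lra.
  - move=> k ik; have : t0 <= U k j by apply: bigmin_le_cond.
    by lra.
pose Z k l := if (k == i) && (l == j) then t else U k l.
have UZ k l : U k l <= Z k l.
  by rewrite /Z; case: ifP => // /andP[/eqP-> /eqP->]; exact: ltW.
have Zij : Z i j = t by rewrite /Z !eqxx.
have ZP : perron_class Z.
  split.
  - by move=> k l; rewrite /Z; case: ifP => // _; exact: perron_negative.
  - move=> k m l km; rewrite {1}/Z; case: ifP => [/andP[/eqP ki /eqP->]|_].
      rewrite /Z eqxx andbT; case: eqP => // mi; apply: troom.
      rewrite ltn_neqAle -ki km andbT; apply/eqP => /val_inj kk.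
      by apply: mi; rewrite -kk.
    exact: le_trans (perron_nondecreasing _ _ _ km) (UZ _ _).
  - move=> k l; have [/andP[/eqP-> /eqP->]|kl] := boolP ((k == i) && (l == j)).
      apply: (le_trans (ltW tpos)); rewrite /residual Zij.
      by apply: ler_defect.
    (* Away from [(i, j)] only neighbouring values may have risen, which cannot lower the defect. *)
    apply: (le_trans (perron_residual_ge0 k l)); rewrite /residual.
    have -> : Z k l = U k l by rewrite /Z (negbTE kl).
    by apply: ler_defect => //; exact: perron_negative.
by have := perron_ub _ i j ZP; rewrite Zij leNgt Ut.
Qed.

Lemma perron_residual_le0 i j : residual U i j <= 0.
Proof.
(* Induction on the distance to the right end, where the condition of [perron_no_room] is
   vacuous. *)
have [m] := ubnP (n - i); elim: m i => // m IH i im.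
have [i_n|n_i] := ltnP i n; last first.
  apply: perron_no_room => k ik; have := ltn_ord k.
  by rewrite ltnS leqNgt (leq_ltn_trans n_i ik).
have ii : (inord i.+1 : 'I_n.+1) = i.+1 :> nat by rewrite inordK.
have le_next : U i j <= U (inord i.+1) j.
  by apply: perron_nondecreasing; rewrite ii.
have [flat|] := eqVneq (U i j) (U (inord i.+1) j); last first.
  move=> neq; apply: perron_no_room => k ik.
  apply: (@lt_le_trans _ _ (U (inord i.+1) j)); first by rewrite lt_neqAle neq.
  by apply: perron_nondecreasing; rewrite ii.
(* On a plateau a positive residual at [i] propagates to [i + 1], because the
   flux is nonpositive at [i] and nonnegative at [i + 1]. *)
apply: (@le_trans _ _ (residual U (inord i.+1) j)); last first.
  by apply: IH; rewrite ii subnS -ltnS prednK ?subn_gt0.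
have prev : inord (inord i.+1 : 'I_n.+1).-1 = i by rewrite ii/= inord_val.
rewrite /residual /defect prev -flat; apply: lerB => //; apply: lerD.
  apply: (@le_trans _ _ 0).
    exact: flux_plateau_left (perron_negative i j) i_n.
  by apply: flux_plateau_right; rewrite ?ii ?perron_negative.
(* The coupling term is at least as large at [i + 1], as [U] is nondecreasing in the other state as
   well. *)
rewrite ler_pM2l ?(lam_gt0 hP)// lerB//.
by apply: perron_nondecreasing; rewrite ii.
Qed.

Lemma perron_solution : solution P U.
Proof.
split=> [|i j]; first exact: perron_negative.
rewrite rhsE; [|exact: perron_negative|exact: perron_nondecreasing].
have -> : residual U i j = 0.
  by apply/le_anti; rewrite perron_residual_le0 perron_residual_ge0.
by rewrite add0r.
Qed.

End GridProblem.

Theorem proposition4p3 (R : realType) (P : params R) (n : nat)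
  (hP : standing P) (hn : (1 <= n)%N) (htheta : 1 <= theta P) :
  solution P (perron P (n := n)).
Proof. exact: perron_solution. Qed.
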